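(* Let $X$ be the Markov mixture process on $\mathbb{S}=E\cup\{\Delta\}$, let $\Gamma_1,\dots,\Gamma_p$ be nonempty stochastically closed subsets of $\mathbb{S}$ with $\bigcap_{l=1}^p\Gamma_l=\{\Delta\}$, and $\tau_l=\inf\{t\ge0:X_t\in\Gamma_l\}$. Let $t_{i_p}\ge\dots\ge t_{i_1}\ge t_{i_0}=t\ge0$ be the time ordering of $(t_1,\dots,t_p)\in\mathbb{R}_+^p$, where $(i_1,\dots,i_p)$ is a permutation of $(1,\dots,p)$. Then the $\mathcal{G}_t$-conditional joint distribution of $\{\tau_l\}$ is $$\overline F_t(t_{i_1},\dots,t_{i_p})=\mathbb{P}\big\{\tau_{i_1}>t_{i_1},\dots,\tau_{i_p}>t_{i_p}\mid\mathcal{G}_t\big\}=\sum_{k=1}^m\boldsymbol\pi^{\top}(t)\mathbf{S}^{(k)}(t)\Big(\prod_{l=1}^p e^{\mathbf{B}^{(k)}(t_{i_l}-t_{i_{l-1}})}\mathbf{H}_{i_l}\Big)\mathbb{1},$$ with $\sum_{k=1}^m\mathbf{S}^{(k)}(t)=\mathbf{I}$, where the matrix product is ordered from left ($l=1$) to right ($l=p$).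
   Context: Mixture process: $E=\{1,\dots,n\}$ are the transient states, $\Delta=n+1$ is the absorbing state, $\mathbb{S}=E\cup\{\Delta\}$. For $k=1,\dots,m$, $\mathbf{Q}^{(k)}=\begin{pmatrix}\mathbf{B}^{(k)}&-\mathbf{B}^{(k)}\mathbb{1}\\ \mathbf{0}&0\end{pmatrix}$ is an intensity matrix on $\mathbb{S}$ (nonnegative off-diagonal entries, zero row sums) with $\mathbf{B}^{(k)}$ an $n\times n$ nonsingular matrix. On a probability space there are an unobserved regime $\phi\in\{1,\dots,m\}$ and an $\mathbb{S}$-valued right-continuous process $X=(X_t)_{t\ge0}$ such that $\mathbb{P}\{X_0=i\}=\pi_i$ for $i\in E$, $\mathbb{P}\{X_0=\Delta\}=0$, $\mathbb{P}\{\phi=k\mid X_0=i\}=s_i^{(k)}$ with $\sum_k s_i^{(k)}=1$, and, given $\phi=k$ and $X_0=i$, $X$ is a time-homogeneous Markov jump process with intensity matrix $\mathbf{Q}^{(k)}$ started at $i$. Closed sets: $\Gamma_l$ stochastically closed means $[\mathbf{Q}^{(k)}]_{i,j}=0$ for all $k$ whenever $i\in\Gamma_l$, $j\in\Gamma_l^c$. It is assumed that $\pi_i\ne0$ for $i\in\bigcap_l\Gamma_l^c$ and $\mathbb{P}\{\tau_1>0,\dots,\tau_p>0\}=1$. $\mathbf{H}_l$ is the $n\times n$ diagonal matrix with $[\mathbf{H}_l]_{ii}=1$ if $i\in\Gamma_l^c$ and $0$ otherwise, $i\in E$. Information: $\mathcal{F}_{t-}$ is any sub-$\sigma$-field of $\sigma(X_s:0\le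 s<t)$ (full, partial, or no information). $\mathcal{F}_{t,i}$ denotes $\mathcal{F}_{t-}$ together with $X_t=i$: $\mathbb{P}\{A\mid\mathcal{F}_{t,i}\}:=\mathbb{P}\{A\cap\{X_t=i\}\mid\mathcal{F}_{t-}\}/\mathbb{P}\{X_t=i\mid\mathcal{F}_{t-}\}$ where the denominator is positive. $\mathcal{G}_t$ is either $\mathcal{F}_{t-}$ together with the event $X_t\ne\Delta$, meaning $\mathbb{P}\{A\mid\mathcal{G}_t\}:=\mathbb{P}\{A\cap\{X_t\ne\Delta\}\mid\mathcal{F}_{t-}\}/\mathbb{P}\{X_t\ne\Delta\mid\mathcal{F}_{t-}\}$ where the denominator is positive, or simply $\mathcal{G}_t=\mathcal{F}_{t-}$. Identities are almost sure, where defined. $\boldsymbol\pi(t)=(\pi_1(t),\dots,\pi_n(t))^\top$ with $\pi_i(t)=\mathbb{P}\{X_t=i\mid\mathcal{G}_t\}$; $\mathbf{S}^{(k)}(t)=\mathrm{diag}(s_1^{(k)}(t),\dots,s_n^{(k)}(t))$ with $s_i^{(k)}(t)=\mathbb{P}\{\phi=k\mid\mathcal{F}_{t,i}\}$ (completed arbitrarily to nonnegative weights summing to $1$ over $k$ where undefined). $\mathbb{1}$ is the all-ones vector. *)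

(* Defs.v *)
From HB Require Import structures.
From mathcomp Require Import all_boot all_order all_algebra all_fingroup.
From mathcomp Require Import all_classical all_reals all_analysis.
Set Implicit Arguments.
Unset Strict Implicit.
Unset Printing Implicit Defensive.
Import Order.TTheory GRing.Theory Num.Theory.
Import numFieldNormedType.Exports.
Local Open Scope classical_set_scope.
Local Open Scope ring_scope.

(* The transient states are 'I_n, embedded by
   [lshift 1] into the full state space 'I_(n + 1), so that block matrices
   follow the decomposition E + {Delta}. *)
Definition state (n : nat) := 'I_(n + 1).
Definition trans (n : nat) (i : 'I_n) : state n := lshift 1 i.
Definition Delta (n : nat) : state n := rshift n ord0.

Definition expmx (R : realType) (n : nat) (A : 'M[R]_n) : 'M[R]_n :=
  lim (series (fun k : nat => (k`!%:R)^-1 *: A ^+ k) @ \oo).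

Definition intensity_matrix (R : realType) (N : nat) (Q : 'M[R]_N) : Prop :=
  (forall i j, i != j -> 0 <= Q i j) /\ (forall i, \sum_j Q i j = 0).

Definition Qmx (R : realType) (n : nat) (B : 'M[R]_n) : 'M[R]_(n + 1) :=
  block_mx B (- (B *m const_mx 1)) 0 0.

(* Standard (continuous at 0) Markov semigroup on a finite state space; the
   intensity matrix is its right derivative at 0. *)
Definition transition_semigroup (R : realType) (N : nat)
    (Pt : R -> 'M[R]_N) : Prop :=
  [/\ Pt 0 = 1%:M,
      forall t u, 0 <= t -> 0 <= u -> Pt (t + u) = Pt t *m Pt u,
      forall t i j, 0 <= t -> 0 <= Pt t i j &
      forall t i, 0 <= t -> \sum_j Pt t i j = 1].

Definition has_intensity (R : realType) (N : nat)
    (Pt : R -> 'M[R]_N) (Q : 'M[R]_N) : Prop :=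
  (h^-1 *: (Pt h - 1%:M)) @[h --> 0^'+] --> Q.

(* Elementary conditional probability P(A | C), meaningful for P(C) > 0. *)
Definition cpr d (T : measurableType d) (R : realType) (P : probability T R)
    (A C : set T) : R :=
  fine (P (A `&` C)) / fine (P C).

Definition at_state (R : realType) (T : Type) (N : nat)
    (X : R -> T -> 'I_N) (t : R) (j : 'I_N) : set T :=
  [set w | X t w = j].

Definition history_is (R : realType) (T : Type) (N : nat)
    (X : R -> T -> 'I_N) (h : seq (R * 'I_N)) : set T :=
  [set w | all (fun u => X u.1 w == u.2) h].

(* Under P(. | C), X is a time-homogeneous Markov jump process with intensity
   matrix Q started at i.  The transition function is quantified existentially
   and is tied to Q only through its derivative at 0. *)
Definition markov_jump_given d (T : measurableType d) (R : realType)
    (P : probability T R) (C : set T) (N : nat) (X : R -> T -> 'I_N)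
    (i : 'I_N) (Q : 'M[R]_N) : Prop :=
  exists Pt : R -> 'M[R]_N,
    [/\ transition_semigroup Pt,
        has_intensity Pt Q,
        cpr P (at_state X 0 i) C = 1 &
        forall (t u : R) (x y : 'I_N) (h : seq (R * 'I_N)),
          0 <= t -> 0 <= u -> all (fun v => 0 <= v.1 <= t) h ->
          let past := history_is X h `&` at_state X t x `&` C in
          (0 < P past)%E ->
          cpr P (at_state X (t + u) y) past = Pt u x y].

(* Right-continuity is for the discrete topology on the state space. *)
Definition right_continuous_path (R : realType) (S : Type) (x : R -> S) :
    Prop :=
  forall t, 0 <= t -> \forall u \near t^'+, x u = x t.

Definition regime_is (T : Type) (m : nat) (phi : T -> 'I_m) (k : 'I_m) :
    set T :=
  [set w | phi w = k].

Record mixture_process d (T : measurableType d) (R : realType)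
    (P : probability T R) (n m : nat) (B : 'I_m -> 'M[R]_n)
    (pi0 : 'I_n -> R) (s : 'I_m -> 'I_n -> R)
    (phi : T -> 'I_m) (X : R -> T -> state n) : Prop := MixtureProcess {
  mp_intensity : forall k, intensity_matrix (Qmx (B k));
  mp_nonsingular : forall k, B k \in unitmx;
  mp_regime_measurable : forall k, measurable (regime_is phi k);
  mp_state_measurable : forall t j, 0 <= t -> measurable (at_state X t j);
  mp_right_continuous : forall w, right_continuous_path (X^~ w);
  mp_init : forall i, P (at_state X 0 (trans i)) = (pi0 i)%:E;
  mp_init_Delta : P (at_state X 0 (Delta n)) = 0%E;
  mp_mixing_sum : forall i, \sum_k s k i = 1;
  mp_mixing : forall k i, (0 < P (at_state X 0 (trans i)))%E ->
    cpr P (regime_is phi k) (at_state X 0 (trans i)) = s k i;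
  mp_markov : forall k i,
    let C := regime_is phi k `&` at_state X 0 (trans i) in
    (0 < P C)%E -> markov_jump_given P C X (trans i) (Qmx (B k))
}.

Definition stochastically_closed (R : realType) (n m : nat)
    (B : 'I_m -> 'M[R]_n) (G : {set state n}) : Prop :=
  forall k i j, i \in G -> j \notin G -> Qmx (B k) i j = 0.

(* The value is +oo when the set is never entered. *)
Definition hitting_time (R : realType) (T : Type) (n : nat)
    (X : R -> T -> state n) (G : {set state n}) (w : T) : \bar R :=
  ereal_inf [set (u%:E)%E | u in [set u : R | 0 <= u /\ X u w \in G]].

Definition Hmx (R : realType) (n : nat) (G : {set state n}) : 'M[R]_n :=
  diag_mx (\row_i (trans i \notin G)%:R).

(* The sigma-field generated by X_s, 0 <= s < t. *)
Definition strict_past (R : realType) (T : Type) (n : nat)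
    (X : R -> T -> state n) (t : R) : set (set T) :=
  <<s [set A | exists u j, 0 <= u < t /\ A = at_state X u j] >>.

(* Y is a version of P(A | F). *)
Definition cond_prob_version d (T : measurableType d) (R : realType)
    (P : probability T R) (F : set (set T)) (A : set T) (Y : T -> R) : Prop :=
  [/\ forall D : set R, measurable D -> F (Y @^-1` D),
      P.-integrable setT (EFin \o Y) &
      forall D, F D -> (\int[P]_(w in D) (Y w)%:E = P (A `&` D))%E].

(* cP is an arbitrary choice, event by event, of versions of P(. | F). *)
Definition cond_prob d (T : measurableType d) (R : realType)
    (P : probability T R) (F : set (set T)) (cP : set T -> T -> R) : Prop :=
  forall A, measurable A -> cond_prob_version P F A (cP A).

(* P(A | F together with the event C), meaningful where cP C w > 0. *)
Definition cond_prob_with (R : realType) (T : Type) (cP : set T -> T -> R)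
    (C A : set T) (w : T) : R :=
  cP (A `&` C) w / cP C w.

(* The information G_t: [true] stands for F_{t-} together with the event
   X_t <> Delta, [false] for F_{t-} alone. *)
Definition cond_G (R : realType) (T : Type) (n : nat)
    (cP : set T -> T -> R) (X : R -> T -> state n) (t : R) (alive : bool)
    (A : set T) (w : T) : R :=
  if alive then cond_prob_with cP (~` at_state X t (Delta n)) A w else cP A w.

Definition cond_G_defined (R : realType) (T : Type) (n : nat)
    (cP : set T -> T -> R) (X : R -> T -> state n) (t : R) (alive : bool)
    (w : T) : Prop :=
  alive -> 0 < cP (~` at_state X t (Delta n)) w.

Definition pi_row (R : realType) (T : Type) (n : nat)
    (cP : set T -> T -> R) (X : R -> T -> state n) (t : R) (alive : bool)
    (w : T) : 'rV[R]_n :=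
  \row_i cond_G cP X t alive (at_state X t (trans i)) w.

(* [c] is the completion used where P(phi = k | F_{t,i}) is undefined. *)
Definition Smx (R : realType) (T : Type) (n m : nat)
    (cP : set T -> T -> R) (phi : T -> 'I_m) (X : R -> T -> state n)
    (c : 'I_m -> 'I_n -> T -> R) (t : R) (k : 'I_m) (w : T) : 'M[R]_n :=
  diag_mx (\row_i
    if 0 < cP (at_state X t (trans i)) w
    then cond_prob_with cP (at_state X t (trans i)) (regime_is phi k) w
    else c k i w).

(* The sequence t_{i_0} = t, t_{i_1}, .., t_{i_p} (offset by one: the entry of
   rank l.+1 is the time of index i (l : 'I_p)). *)
Definition ordered_times (R : realType) (p : nat) (t : R) (tt : 'I_p -> R)
    (i : 'S_p) : seq R :=
  t :: [seq tt (i l) | l <- enum 'I_p].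

(* Ordered product, in the (noncommutative) matrix ring, from left to right. *)
Definition survival_product (R : realType) (n p : nat) (B : 'M[R]_n)
    (G : 'I_p -> {set state n}) (t : R) (tt : 'I_p -> R) (i : 'S_p) :
    'M[R]_n :=
  let ts := ordered_times t tt i in
  \prod_(l < p) (expmx ((ts`_l.+1 - ts`_l) *: B) *m Hmx R (G (i l))).

(* Main.v *)
Require Import Defs.
From HB Require Import structures.
From mathcomp Require Import all_boot all_order all_algebra all_fingroup.
From mathcomp Require Import all_classical all_reals all_analysis.
From mathcomp Require Import measurable_realfun ring lra.
Set Implicit Arguments.
Unset Strict Implicit.
Unset Printing Implicit Defensive.
Import Order.TTheory GRing.Theory Num.Theory.
Import numFieldNormedType.Exports.
Local Open Scope classical_set_scope.
Local Open Scope ring_scope.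

(* X_s stays almost surely in a closed set once it has entered it, so by right
   continuity {tau_l > u} is, up to a null set, {X_u notin Gamma_l}, and the
   event of the theorem only involves X at the ordered times. Given the regime
   k, the Markov property extends by a Dynkin argument from cylinders to the
   strict past, and turns the probability of avoiding each set at its time into
   the matrix product; as Delta lies in every closed set, only the transient
   block matters. A transition semigroup with intensity Q is e^{uQ} because both
   are the limit of (1 + uQ/N)^N; block triangularity and the zero pattern of
   closed sets pass from the powers to this limit. Integrating over events of
   F_{t-} characterises the conditional probabilities, and summing over the
   regime and the state at time t gives the formula. *)

(** * Matrix exponential and transition semigroups *)

(** A bound on the operator norm induced by the sup norm, hence submultiplicative; stochastic
    matrices satisfy it with bound 1. *)
Definition mxrow_le (R : realType) (n : nat) (M : 'M[R]_n) (a : R) : Prop :=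
  forall i, \sum_j `|M i j| <= a.

Lemma mxrow_le_entry (R : realType) (n : nat) (M : 'M[R]_n) (a : R) i j :
  mxrow_le M a -> `|M i j| <= a.
Proof.
by move=> /(_ i); apply: le_trans; rewrite (bigD1 j) //= lerDl sumr_ge0.
Qed.

Lemma mxrow_leD (R : realType) (n : nat) (M N : 'M[R]_n) (a b : R) :
  mxrow_le M a -> mxrow_le N b -> mxrow_le (M + N) (a + b).
Proof.
move=> hM hN i; apply: le_trans (lerD (hM i) (hN i)).
by rewrite -big_split /=; apply: ler_sum => j _; rewrite mxE ler_normD.
Qed.

Lemma mxrow_leZ (R : realType) (n : nat) (M : 'M[R]_n) (a c : R) :
  mxrow_le M a -> mxrow_le (c *: M) (`|c| * a).
Proof.
move=> hM i; apply: le_trans (ler_wpM2l (normr_ge0 c) (hM i)).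
by rewrite mulr_sumr; apply: ler_sum => j _; rewrite mxE normrM.
Qed.

Lemma mxrow_leM (R : realType) (n : nat) (M N : 'M[R]_n) (a b : R) :
  0 <= b -> mxrow_le M a -> mxrow_le N b -> mxrow_le (M *m N) (a * b).
Proof.
move=> b0 hM hN i; apply: le_trans (ler_wpM2r b0 (hM i)).
apply: (@le_trans _ _ (\sum_j \sum_k `|M i k| * `|N k j|)).
  apply: ler_sum => j _; rewrite mxE; apply: le_trans (ler_norm_sum _ _ _) _.
  by apply: ler_sum => k _; rewrite normrM.
rewrite exchange_big mulr_suml; apply: ler_sum => k _.
by rewrite -mulr_sumr ler_wpM2l.
Qed.

Lemma mxrow_le1 (R : realType) (n : nat) : mxrow_le (1 : 'M[R]_n) 1.
Proof.
move=> i; rewrite (bigD1 i) //= mxE eqxx normr1 big1 ?addr0 // => j ji.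
by rewrite mxE eq_sym (negbTE ji) normr0.
Qed.

Lemma mxrow_leX (R : realType) (n k : nat) (M : 'M[R]_n) (a : R) :
  0 <= a -> mxrow_le M a -> mxrow_le (M ^+ k) (a ^+ k).
Proof.
move=> a0 hM; elim: k => [|k IH]; first exact: mxrow_le1.
by rewrite !exprS; apply: mxrow_leM => //; exact: exprn_ge0.
Qed.

Lemma mxrow_le_sum (R : realType) (n : nat) (I : Type) (r : seq I)
    (M : I -> 'M[R]_n) (a : I -> R) :
  (forall i, mxrow_le (M i) (a i)) ->
  mxrow_le (\sum_(i <- r) M i) (\sum_(i <- r) a i).
Proof.
move=> hM; elim: r => [|i r IH]; last by rewrite !big_cons; exact: mxrow_leD.
by rewrite !big_nil => i; rewrite big1 // => j _; rewrite mxE normr0.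
Qed.

Lemma mxrow_le_stochastic (R : realType) (n : nat) (M : 'M[R]_n) :
  (forall i j, 0 <= M i j) -> (forall i, \sum_j M i j = 1) -> mxrow_le M 1.
Proof.
by move=> M0 M1 i; rewrite -(M1 i) ler_sum // => j _; rewrite ger0_norm.
Qed.

Lemma mxrow_le_exists (R : realType) (n : nat) (M : 'M[R]_n) :
  exists2 a, 0 <= a & mxrow_le M a.
Proof.
exists (\sum_i \sum_j `|M i j|); first by apply: sumr_ge0 => i _; exact: sumr_ge0.
move=> i; rewrite [leRHS](bigD1 i) //= lerDl.
by apply: sumr_ge0 => k _; exact: sumr_ge0.
Qed.

(* Telescoping: powers of contractions are Lipschitz in the base. *)
Lemma mxrow_le_subX (R : realType) (n k : nat) (M N : 'M[R]_n) (e : R) :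
  mxrow_le M 1 -> mxrow_le N 1 -> mxrow_le (M - N) e ->
  mxrow_le (M ^+ k - N ^+ k) (k%:R * e).
Proof.
move=> hM hN hMN; elim: k => [|k IH].
  by rewrite subrr mul0r => i; rewrite big1 // => j _; rewrite mxE normr0.
have -> : M ^+ k.+1 - N ^+ k.+1 = M *m (M ^+ k - N ^+ k) + (M - N) *m N ^+ k.
  by rewrite !exprS -!mulmxE mulmxBr mulmxBl addrA subrK.
have [hn|hn] := posnP n.
  by move=> i; move: (ltn_ord i); rewrite [X in (_ < X)%N]hn.
have e0 : 0 <= e by apply: le_trans (hMN (Ordinal hn)); exact: sumr_ge0.
rewrite -natr1 mulrDl mul1r; apply: mxrow_leD.
  by rewrite -[X in mxrow_le _ X]mul1r; apply: mxrow_leM => //; exact: mulr_ge0.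
rewrite -[X in mxrow_le _ X]mulr1; apply: mxrow_leM => //.
by rewrite -[X in mxrow_le _ X](expr1n _ k); exact: mxrow_leX.
Qed.

(** For small [h] the matrix [1 + h *: Q] is stochastic: its rows sum to 1, and its diagonal stays
    nonnegative once [h] times a bound on [Q] is at most 1. *)
Lemma mxrow_le_near_intensity (R : realType) (n : nat) (Q : 'M[R]_n) :
  intensity_matrix Q -> \forall h \near 0^'+, mxrow_le (1 + h *: Q) 1.
Proof.
move=> [Q0 Q1]; have [a a0 hQ] := mxrow_le_exists Q.
near=> h.
have h0 : 0 < h by near: h; exact: nbhs_right_gt.
(* Adding 1 to [a] keeps the divisor positive even when [a = 0]. *)
have ha : h * (a + 1) <= 1.
  rewrite -ler_pdivlMr ?ltr_wpDl // div1r; near: h; apply: nbhs_right_le.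
  by rewrite invr_gt0 ltr_wpDl.
apply: mxrow_le_stochastic => [i j|i].
  rewrite !mxE; case: eqVneq => [<-|ij] /=.
    have : `|h * Q i i| <= 1.
      rewrite normrM gtr0_norm //; apply: le_trans ha; rewrite ler_pM2l //.
      by apply: le_trans (mxrow_le_entry i i hQ) _; rewrite lerDl.
    by rewrite ler_norml => /andP[+ _]; rewrite mulr1n; lra.
  by rewrite add0r mulr_ge0 ?(ltW h0) ?Q0.
under eq_bigr => j _ do rewrite !mxE.
rewrite big_split /= -mulr_sumr Q1 mulr0 addr0 (bigD1 i) //= eqxx big1 ?addr0 //.
by move=> j; rewrite eq_sym => /negbTE ->.
Unshelve. all: by end_near. Qed.

Lemma cvg_mx_entry (R : realType) (n : nat) (T : Type) (F : set_system T)
    (FF : Filter F) (f : T -> 'M[R]_n) (M : 'M[R]_n) :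
  f x @[x --> F] --> M <-> forall i j, f x i j @[x --> F] --> M i j.
Proof.
split.
  move=> fM i j; apply: (cvg_comp f (fun N : 'M[R]_n => N i j) fM).
  exact: coord_continuous.
move=> fM; apply/cvg_ballP => e e0.
have : \forall x \near F, forall i j, ball (M i j) e (f x i j).
  apply: filter_forall => i; apply: filter_forall => j.
  by move/cvg_ballP : (fM i j); apply.
by apply: filterS => x hx; split => // i j; exact: hx.
Qed.

(** * Euler's limit for the matrix exponential *)

Lemma bernoulli_ineq (R : realDomainType) (n : nat) (y : R) :
  0 <= y <= 1 -> 1 - n%:R * y <= (1 - y) ^+ n.
Proof.
move=> /andP[y0 y1]; elim: n => [|n IH]; first by rewrite mul0r subr0.
rewrite exprS; have y1' : 0 <= 1 - y by rewrite subr_ge0.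
apply: le_trans (ler_wpM2l y1' IH).
have ny : 0 <= n%:R * y * y by rewrite !mulr_ge0.
by rewrite -natr1; lra.
Qed.

(* Uses [(1 - x) e ^ x <= 1], hence [(1 - x ^ 2) e ^ x <= 1 + x], for
   [x = a / n.+1], then Bernoulli's inequality. *)
Lemma expR_euler_ge (R : realType) (a : R) (n : nat) :
  0 <= a -> a <= n.+1%:R ->
  expR a * (1 - a ^+ 2 / n.+1%:R) <= (1 + n.+1%:R^-1 * a) ^+ n.+1.
Proof.
move=> a0 an; set N : R := n.+1%:R; have N0 : 0 < N by rewrite ltr0n.
set x := N^-1 * a.
have x0 : 0 <= x by rewrite mulr_ge0 // invr_ge0 ltW.
have x1 : x <= 1 by rewrite /x mulrC ler_pdivrMr // mul1r.
have Nx : N * x = a by rewrite /x mulVKf // gt_eqF.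
have hx : expR x * (1 - x ^+ 2) <= 1 + x.
  have : expR x * (1 - x) <= 1.
    rewrite -[leRHS](expRxMexpNx_1 x) ler_pM2l ?expR_gt0 //; exact: expR_ge1Dx.
  have x0' : 0 <= 1 + x by rewrite addr_ge0.
  move=> /(ler_wpM2l x0'); rewrite mulr1; apply: le_trans.
  by rewrite le_eqVlt; apply/orP; left; apply/eqP; ring.
have x2 : 0 <= x ^+ 2 <= 1 by rewrite exprn_ge0 // expr_le1.
apply: (@le_trans _ _ ((expR x * (1 - x ^+ 2)) ^+ n.+1)); last first.
  rewrite lerXn2r // nnegrE ?addr_ge0 // mulr_ge0 ?expR_ge0 // subr_ge0.
  by case/andP: x2.
rewrite exprMn -expRM_natl -/N Nx ler_pM2l ?expR_gt0 //.
apply: le_trans (bernoulli_ineq n.+1 x2); rewrite -/N lerD2l lerN2.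
rewrite le_eqVlt; apply/orP; left; apply/eqP; rewrite -Nx; field.
by rewrite gt_eqF.
Qed.

(** With [N = n.+1], the binomial coefficient is a falling factorial of [N] over [k!], and that
    falling factorial is at most [N ^ k]. *)
Lemma euler_coeff_le (R : realFieldType) (n k : nat) :
  0 <= k`!%:R^-1 - n.+1%:R^-1 ^+ k * 'C(n.+1, k)%:R :> R.
Proof.
rewrite subr_ge0 exprVn mulrC.
rewrite -[leRHS]div1r ler_pdivlMr ?ltr0n ?fact_gt0 // mulrAC -natrM bin_ffact.
rewrite ler_pdivrMr ?exprn_gt0 ?ltr0n // mul1r -natrX ler_nat.
elim: k n => [//|k IH] n; rewrite ffactSS expnS leq_mul2l /=.
case: n => [|n]; first by case: k {IH} => // k; rewrite ffact_small.
by apply: leq_trans (IH n) _; case: k {IH} => // k; rewrite leq_exp2r.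
Qed.

Lemma scalemxX (R : comPzRingType) (n k : nat) (c : R) (A : 'M[R]_n) :
  (c *: A) ^+ k = c ^+ k *: A ^+ k.
Proof.
elim: k => [|k IH]; first by rewrite !expr0 scale1r.
by rewrite !exprS IH -!mulmxE -scalemxAl -scalemxAr scalerA.
Qed.

(** [expmx] is a bare [lim], so convergence has to be established: each entry is dominated by the
    scalar exponential series of a row bound of [A]. *)
Lemma cvg_expmx (R : realType) (n : nat) (A : 'M[R]_n) i j :
  series (fun k => (k`!%:R)^-1 *: A ^+ k) N i j @[N --> \oo] --> expmx A i j.
Proof.
have [a a0 hA] := mxrow_le_exists A.
pose u i j (k : nat) : R := (k`!%:R)^-1 * (A ^+ k) i j.
have uE i' j' N : series (fun k => (k`!%:R)^-1 *: A ^+ k) N i' j' =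
    series (u i' j') N.
  by rewrite /series /= summxE; apply: eq_bigr => k _; rewrite mxE.
have ucvg i' j' : cvgn (series (u i' j')).
  apply: normed_cvg; apply: series_le_cvg (is_cvg_series_exp_coeff a) => k.
  - exact: normr_ge0.
  - exact: exp_coeff_ge0.
  - rewrite /exp_coeff /u /= normrM ger0_norm ?invr_ge0 ?ler0n // mulrC.
    rewrite ler_wpM2r ?invr_ge0 ?ler0n //.
    exact: (mxrow_le_entry _ _ (mxrow_leX _ a0 hA)).
move: i j; apply/(@cvg_mx_entry _ _ _ (nbhs \oo)).
apply: (cvgP (\matrix_(i, j) limn (series (u i j)))).
apply/cvg_mx_entry => i j; rewrite mxE.
by rewrite (_ : (fun N => _) = series (u i j)) //; apply/funext => N; exact: uE.
Qed.

(* The coefficients of [A ^ k] in the exponential series dominate those in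
   [(1 + A / N) ^ N], so the error for a matrix is controlled by the scalar one. *)
Lemma expmx_euler (R : realType) (n : nat) (A : 'M[R]_n) i j :
  ((1 + N.+1%:R^-1 *: A) ^+ N.+1) i j @[N --> \oo] --> expmx A i j.
Proof.
have [a a0 hA] := mxrow_le_exists A.
pose S N := series (fun k => (k`!%:R)^-1 *: A ^+ k) N.
(* The partial sum with [N.+2] terms has as many terms as the binomial expansion of a power
   [N.+1]. *)
have Scvg : S N.+2 i j @[N --> \oo] --> expmx A i j.
  have h : (fun N => S N i j) @ \oo --> expmx A i j by exact: cvg_expmx.
  by move: h; rewrite -cvg_shiftS -cvg_shiftS.
pose D N : R := ((1 + N.+1%:R^-1 *: A) ^+ N.+1) i j - S N.+2 i j.
(* This is the error left by [expR_euler_ge] for the scalar [a]. *)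
have Dle : \forall N \near \oo, `|D N| <= expR a * a ^+ 2 * N.+1%:R^-1.
  near=> N.
  have aN : a <= N.+1%:R.
    have : a <= N%:R by near: N; exact: nbhs_infty_ger.
    by move=> h; rewrite (le_trans h) // ler_nat.
  pose c k : R := k`!%:R^-1 - N.+1%:R^-1 ^+ k * 'C(N.+1, k)%:R.
  have SE : S N.+2 - (1 + N.+1%:R^-1 *: A) ^+ N.+1 =
      \sum_(k < N.+2) c k *: A ^+ k.
    rewrite /S /series /= big_mkord addrC [1 + _]addrC exprD1n -sumrN -big_split.
    apply: eq_bigr => k _; rewrite scalemxX -scaler_nat scalerA /=.
    by rewrite /c scalerBl addrC mulrC.
  have cE : \sum_(k < N.+2) c k * a ^+ k =
      series (exp_coeff a) N.+2 - (1 + N.+1%:R^-1 * a) ^+ N.+1.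
    rewrite /series /= big_mkord [1 + _]addrC exprD1n -sumrN -big_split.
    apply: eq_bigr => k _; rewrite /exp_coeff /= exprMn -[_ *+ 'C(_, _)]mulr_natr /c.
    by rewrite mulrBl mulrAC [_ / k`!%:R]mulrC.
  have hle : mxrow_le (S N.+2 - (1 + N.+1%:R^-1 *: A) ^+ N.+1)
      (\sum_(k < N.+2) c k * a ^+ k).
    rewrite SE; apply: mxrow_le_sum => k.
    rewrite -[c k in X in mxrow_le _ X]ger0_norm ?euler_coeff_le //.
    exact/mxrow_leZ/mxrow_leX.
  have := mxrow_le_entry i j hle; rewrite cE !mxE distrC => /le_trans; apply.
  have sle : series (exp_coeff a) N.+2 <= expR a.
    apply: nondecreasing_cvgn_le; last exact: is_cvg_series_exp_coeff.
    apply/nondecreasing_seqP => k; rewrite /series /= big_nat_recr //= lerDl.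
    exact: exp_coeff_ge0.
  have := expR_euler_ge a0 aN; rewrite mulrBr mulr1 mulrA.
  move: sle; move: (series _ _) ((1 + _) ^+ _) (_ / _) => u v w; lra.
have Dcvg : D N @[N --> \oo] --> 0.
  apply/norm_cvg0P.
  have c0 : expR a * a ^+ 2 * N.+1%:R^-1 @[N --> \oo] --> 0.
    by rewrite -[X in _ --> X](mulr0 (expR a * a ^+ 2)); apply: cvgMr cvg_harmonic.
  apply: (squeeze_cvgr _ (cvg_cst 0) c0).
  by near=> N; rewrite normr_ge0 /=; near: N.
rewrite -[X in _ --> X]add0r.
rewrite (_ : (fun N : nat => _) = (fun N => D N + S N.+2 i j)); last first.
  by apply/funext => N; rewrite subrK.
exact: cvgD.
Unshelve. all: by end_near. Qed.

Lemma expmx_eq_lim (R : realType) (n : nat) (A M : 'M[R]_n) :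
  (forall i j, ((1 + N.+1%:R^-1 *: A) ^+ N.+1) i j @[N --> \oo] --> M i j) ->
  M = expmx A.
Proof.
move=> h; apply/matrixP => i j.
by rewrite -(cvg_lim _ (h i j)) // (cvg_lim _ (@expmx_euler R n A i j)).
Qed.

(** * Identification of transition semigroups *)

(** First-order expansion at 0, in row-sum form. Each entry of the difference quotient is made
    [e / n.+1] close to its limit; the successor avoids dividing by zero. *)
Lemma has_intensity_mxrow_le (R : realType) (n : nat) (Pt : R -> 'M[R]_n)
    (Q : 'M[R]_n) (e : R) : has_intensity Pt Q -> 0 < e ->
  \forall h \near 0^'+, mxrow_le (Pt h - (1 + h *: Q)) (h * e).
Proof.
move=> hQ e0; pose e' := e / n.+1%:R.
have e'0 : 0 < e' by rewrite divr_gt0 ?ltr0n.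
have hent : \forall h \near 0^'+, forall i j,
    `|Q i j - (h^-1 *: (Pt h - 1%:M)) i j| < e'.
  apply: filter_forall => i; apply: filter_forall => j.
  have : (fun h => (h^-1 *: (Pt h - 1%:M)) i j) @ 0^'+ --> Q i j.
    by move: i j; apply/cvg_mx_entry.
  by move/cvgrPdist_lt; apply.
near=> h.
have h0 : 0 < h by near: h; exact: nbhs_right_gt.
have hh : forall i j, `|Q i j - (h^-1 *: (Pt h - 1%:M)) i j| < e' by near: h.
have -> : Pt h - (1 + h *: Q) = h *: (h^-1 *: (Pt h - 1) - Q).
  by rewrite scalerBr scalerA divff ?gt_eqF // scale1r opprD addrA.
have he : mxrow_le (h^-1 *: (Pt h - 1) - Q) e.
  move=> i; apply: (@le_trans _ _ (\sum_(j < n) e')).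
    apply: ler_sum => j _; rewrite !mxE distrC ltW //.
    by have := hh i j; rewrite !mxE.
  rewrite sumr_const card_ord -mulr_natl /e' mulrCA ger_pMr // ler_pdivrMr ?ltr0n //.
  by rewrite mul1r ler_nat.
by rewrite -[h in h * e]gtr0_norm //; exact: mxrow_leZ.
Unshelve. all: by end_near. Qed.

Lemma transition_semigroupX (R : realType) (n k : nat) (Pt : R -> 'M[R]_n)
    (h : R) :
  transition_semigroup Pt -> 0 <= h -> Pt (k%:R * h) = Pt h ^+ k.
Proof.
move=> [P0 PD _ _] h0; elim: k => [|k IH]; first by rewrite mul0r P0.
by rewrite -natr1 addrC mulrDl mul1r PD ?mulr_ge0 // IH exprS.
Qed.

(** The semigroup law writes [Pt u] as the [N]-th power of [Pt (u / N)]. That matrix and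
    [1 + (u / N) *: Q] are contractions for large [N], so [mxrow_le_subX] compares their powers. *)
Lemma transition_semigroup_expmx (R : realType) (n : nat) (Pt : R -> 'M[R]_n)
    (Q : 'M[R]_n) (u : R) :
  intensity_matrix Q -> transition_semigroup Pt -> has_intensity Pt Q ->
  0 <= u -> Pt u = expmx (u *: Q).
Proof.
move=> IQ PtS hPt; rewrite le_eqVlt => /predU1P[<-|u0].
  apply: expmx_eq_lim => i j; case: PtS => -> _ _ _.
  rewrite (_ : (fun _ => _) = cst (1%:M i j)); first exact: cvg_cst.
  by apply/funext => N; rewrite scale0r scaler0 addr0 expr1n.
apply: expmx_eq_lim => i j; apply/cvgrPdist_le => e e0.
have hu : u * N.+1%:R^-1 @[N --> \oo] --> (0 : R).
  by rewrite -[X in _ --> X](mulr0 u); apply: cvgMr cvg_harmonic.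
(* An error of [e / u] per unit of time: the steps of total length [u] accumulate at most [e]. *)
have e'0 : 0 < e / u by rewrite divr_gt0.
have H : nbhs (0 : R) (fun h => 0 < h ->
    mxrow_le (1 + h *: Q) 1 /\ mxrow_le (Pt h - (1 + h *: Q)) (h * (e / u))).
  exact: filterI (mxrow_le_near_intensity IQ) (has_intensity_mxrow_le hPt e'0).
have : \forall N \near \oo, 0 < u * N.+1%:R^-1 -> _ := hu _ H.
apply: filterS => N /=.
have N0 : 0 < N.+1%:R :> R by rewrite ltr0n.
have h0 : 0 < u * N.+1%:R^-1 by rewrite divr_gt0.
move=> /(_ h0)[hQ1 hPQ].
have hP1 : mxrow_le (Pt (u * N.+1%:R^-1)) 1.
  case: PtS => _ _ P0 P1; apply: mxrow_le_stochastic => [i' j'|i'].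
    by apply: P0; exact: ltW.
  by apply: P1; exact: ltW.
have := mxrow_le_entry i j (mxrow_le_subX N.+1 hP1 hQ1 hPQ).
rewrite -transition_semigroupX ?(ltW h0) // scalerA [_^-1 * u]mulrC.
rewrite [_%:R * (u / _)]mulrC divfK ?gt_eqF // !mxE => /le_trans; apply.
by rewrite mulrA [_%:R * _]mulrC divfK ?gt_eqF // mulrCA divff ?gt_eqF // mulr1.
Qed.

(** The zero pattern is preserved by products, so the Euler sequence is constantly zero at this
    entry. *)
Lemma expmx_closed (R : realType) (n : nat) (Q : 'M[R]_n) (S : {set 'I_n})
    (u : R) x y :
  (forall i j, i \in S -> j \notin S -> Q i j = 0) ->
  x \in S -> y \notin S -> expmx (u *: Q) x y = 0.
Proof.
move=> QS xS yS; rewrite -(cvg_lim _ (@expmx_euler R n (u *: Q) x y)) //.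
(* Naming the step size [c] lets the induction act on the exponent alone. *)
apply/lim_near_cst => //; near=> N; set c := N.+1%:R^-1.
elim: (N.+1) x xS => [|k IH] x xS.
  by rewrite expr0 mxE; case: eqP => // xy; move: yS; rewrite -xy xS.
rewrite exprS -mulmxE mxE big1 // => z _.
have [zS|zS] := boolP (z \in S); first by rewrite IH // mulr0.
rewrite !mxE QS //; case: eqP => [xz|_]; first by move: zS; rewrite -xz xS.
by rewrite !mulr0 addr0 mul0r.
Unshelve. all: by end_near. Qed.

Lemma expmx_Qmx_trans (R : realType) (n : nat) (B : 'M[R]_n) (u : R) i j :
  expmx (u *: Qmx B) (trans i) (trans j) = expmx (u *: B) i j.
Proof.
rewrite -(cvg_lim _ (@expmx_euler R _ (u *: Qmx B) (trans i) (trans j))) //.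
rewrite -(cvg_lim _ (@expmx_euler R n (u *: B) i j)) //.
rewrite (_ : (fun N : nat => ((1 + _ *: (u *: Qmx B)) ^+ _) _ _) =
  fun N => ((1 + N.+1%:R^-1 *: (u *: B)) ^+ N.+1) i j) //.
apply/funext => N; set c := N.+1%:R^-1.
(* Powers stay block upper triangular, and their upper left block is the power of the transient
   block; the blocks [C] and [D] need no formula. *)
suff [C [D ->]] : exists C D, (1 + c *: (u *: Qmx B)) ^+ N.+1 =
    block_mx ((1 + c *: (u *: B)) ^+ N.+1) C 0 D by rewrite block_mxEul.
elim: N.+1 => [|k [C [D IH]]].
  by exists 0, 1; rewrite !expr0 -[1 in LHS]/(1%:M) -scalar_mx_block.
rewrite exprS -mulmxE IH /Qmx 2!scale_block_mx -[1]/(1%:M) scalar_mx_block.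
rewrite add_block_mx mulmx_block !scaler0 !addr0 !mul0mx !mulmx0 !addr0 !add0r.
by eexists; eexists; rewrite exprS.
Qed.

(** * Conditional probabilities *)

Section finite_total_probability.
Context d (T : measurableType d) (R : realType) (P : probability T R).

Lemma fine_prob_ge0 (A : set T) : 0 <= fine (P A).
Proof. by rewrite fine_ge0. Qed.

Lemma fine_probK (A : set T) : measurable A -> (fine (P A))%:E = P A.
Proof. by move=> mA; rewrite fineK // fin_num_measure. Qed.

Lemma fine_prob_le (A C : set T) : measurable A -> measurable C -> A `<=` C ->
  fine (P A) <= fine (P C).
Proof.
by move=> mA mC AC; rewrite -lee_fin !fine_probK // le_measure // inE.
Qed.

Lemma fine_prob_eq0 (A C : set T) : measurable A -> measurable C -> A `<=` C ->
  fine (P C) = 0 -> fine (P A) = 0.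
Proof.
move=> mA mC AC C0; apply/eqP; rewrite eq_le fine_prob_ge0 andbT -C0.
exact: fine_prob_le.
Qed.

Lemma fine_prob_total (N : nat) (f : T -> 'I_N) (A : set T) :
  (forall i, measurable [set w | f w = i]) -> measurable A ->
  fine (P A) = \sum_i fine (P (A `&` [set w | f w = i])).
Proof.
move=> mf mA; have mAf i : measurable (A `&` [set w | f w = i]) by exact: measurableI.
rewrite sum_fine; last by move=> i _; rewrite fin_num_measure.
rewrite -(measure_bigsetU_ord P xpredT) //; last first.
  by move=> i j _ _ [w [[_ <-] [_ <-]]].
congr (fine (P _)); apply/seteqP; split => [w Aw|w].
  by rewrite (bigD1 (f w)) //=; left.
by elim/big_ind : _ => [//|C D hC hD [/hC|/hD]//|i _ []].
Qed.

Lemma fine_probD (A C : set T) : measurable A -> measurable C -> C `<=` A ->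
  fine (P (A `\` C)) = fine (P A) - fine (P C).
Proof.
move=> mA mC CA; rewrite measureD ?ltey_eq ?fin_num_measure //.
by rewrite (setIidr CA) fineB ?fin_num_measure.
Qed.

Lemma cvg_fine_prob (F : (set T)^nat) (E : set T) :
  (forall k, measurable (F k)) -> measurable E ->
  {homo F : k l / (k <= l)%N >-> (k <= l)%O} ->
  fine (P (F k `&` E)) @[k --> \oo] --> fine (P (\bigcup_k F k `&` E)).
Proof.
move=> mF mE ndF; apply: fine_cvg; rewrite fine_probK; last first.
  by apply: measurableI => //; exact: bigcup_measurable.
rewrite setI_bigcupl; apply: nondecreasing_cvg_mu => [k||k l kl].
- exact: measurableI.
- by apply: bigcup_measurable => k _; exact: measurableI.
- by rewrite subsetEset; apply: setSI; move: (ndF _ _ kl); rewrite subsetEset.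
Qed.

Lemma fine_prob_ae_le (A C : set T) : measurable A -> measurable C ->
  {ae P, forall w, A w -> C w} -> fine (P A) <= fine (P C).
Proof.
move=> mA mC [N [mN N0 hN]].
rewrite -lee_fin !fine_probK //.
apply: (@le_trans _ _ (P (C `|` N))).
  apply: le_measure; rewrite ?inE //; first exact: measurableU.
  move=> w Aw; have [Cw|Cw] := pselect (C w); [by left|right].
  by apply: hN => /= /(_ Aw).
by rewrite measureU0.
Qed.

Lemma fine_prob_ae_eq (A C : set T) : measurable A -> measurable C ->
  {ae P, forall w, A w <-> C w} -> fine (P A) = fine (P C).
Proof.
move=> mA mC AC; apply/eqP; rewrite eq_le !fine_prob_ae_le //.
  by apply: filterS AC => w [].
by apply: filterS AC => w [].
Qed.

End finite_total_probability.

Section conditional_probability.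
Context d (T : measurableType d) (R : realType) (P : probability T R).
Variables (F : set (set T)) (cP : set T -> T -> R).
Hypotheses (F_sigma : sigma_algebra setT F) (F_meas : F `<=` measurable)
  (hcP : cond_prob P F cP).

(** Turning [F] into a measurable type of its own makes the usual closure properties of measurable
    functions available relative to [F]. *)
Lemma sigma_measurable_fun_sum (I : finType) (a : I -> R) (Y : I -> T -> R) :
  (forall i (D : set R), measurable D -> F (Y i @^-1` D)) ->
  forall D : set R, measurable D -> F ((fun w => \sum_i a i * Y i w) @^-1` D).
Proof.
move=> mY D mD; pose TF := g_sigma_algebraType F.
have FE : <<s F>> = F by exact: sigma_algebra_id.
have mYF i : measurable_fun [set: TF] (Y i : TF -> R).
  by move=> _ E mE; rewrite setTI /measurable /= FE; exact: mY.
have mS : measurable_fun [set: TF] (fun w : TF => \sum_i a i * Y i w).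
  by apply: measurable_sum => i; apply: measurable_funM.
by have := mS measurableT D mD; rewrite setTI /measurable /= FE.
Qed.

(* A conditional expectation whose integrals over [F] are nonnegative is
   nonnegative, by integrating over the event where it is negative. *)
Lemma cond_prob_lin_ge0 (I : finType) (a : I -> R) (A : I -> set T) :
  (forall i, measurable (A i)) ->
  (forall D, F D -> 0 <= \sum_i a i * fine (P (A i `&` D))) ->
  {ae P, forall w, 0 <= \sum_i a i * cP (A i) w}.
Proof.
move=> mA hA; pose Y w := \sum_i a i * cP (A i) w.
have mY (D : set R) : measurable D -> F (Y @^-1` D).
  by apply: sigma_measurable_fun_sum => i; case: (hcP (mA i)).
have iYi i : P.-integrable setT (fun w => (a i)%:E * (cP (A i) w)%:E)%E.
  by apply: integrableZl => //; case: (hcP (mA i)).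
have YE w : (Y w)%:E = (\sum_i (a i)%:E * (cP (A i) w)%:E)%E.
  by rewrite /Y -sumEFin; apply: eq_bigr => i _; rewrite EFinM.
have YEf : EFin \o Y = fun w => (\sum_i (a i)%:E * (cP (A i) w)%:E)%E.
  by apply/funext => w; exact: YE.
have iY : P.-integrable setT (EFin \o Y).
  by rewrite YEf; apply: integrable_sum.
pose D := Y @^-1` `]-oo, 0[%classic.
have FD : F D by apply: mY; exact: measurable_itv.
have mD : measurable D by exact: F_meas.
have iYD : (\int[P]_(w in D) (Y w)%:E = (\sum_i a i * fine (P (A i `&` D)))%:E)%E.
  under eq_integral do rewrite YE.
  rewrite integral_sum //; last first.
    by move=> i; apply: integrableS (iYi i).
  rewrite -sumEFin; apply: eq_bigr => i _; rewrite integralZl //; last first.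
    by apply: (@integrableS _ _ _ _ setT) => //; case: (hcP (mA i)).
  rewrite EFinM fine_probK; last exact: measurableI.
  by congr (_ * _)%E; case: (hcP (mA i)) => _ _; apply.
have mYD : measurable_fun D (EFin \o Y).
  by apply: measurable_funTS; case/integrableP: iY.
(* On [D] the integral of the absolute value is minus that of [Y], hence at most 0; so [Y] vanishes
   almost everywhere where it is negative. *)
have : ae_eq P D (EFin \o Y) (cst 0%E).
  apply/(ae_eq_integral_abs P mD mYD)/eqP; rewrite eq_le; apply/andP; split.
    have -> : (\int[P]_(w in D) `|(EFin \o Y) w| = - \int[P]_(w in D) (Y w)%:E)%E.
      rewrite -integralN /=; last first.
        by apply: integrable_add_def => //; exact: integrableS measurableT mD _ iY.
      apply: eq_integral => w; rewrite inE /D /= in_itv /= => Yw.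
      by rewrite ltr0_norm.
    by rewrite iYD oppe_le0 lee_fin hA.
  by apply: integral_ge0.
apply: filterS => w hw; rewrite leNgt; apply/negP => Yw.
have : D w by rewrite /D /= in_itv.
by move/hw => [] Y0; move: Yw; rewrite -/(Y w) Y0 ltxx.
Qed.

(** The nonnegativity result is applied to the difference of the two sides and to its opposite; [A0]
    enters the sum at index [None] with coefficient -1. *)
Lemma cond_prob_lin (I : finType) (a : I -> R) (A : I -> set T) (A0 : set T) :
  measurable A0 -> (forall i, measurable (A i)) ->
  (forall D, F D ->
    fine (P (A0 `&` D)) = \sum_i a i * fine (P (A i `&` D))) ->
  {ae P, forall w, cP A0 w = \sum_i a i * cP (A i) w}.
Proof.
move=> mA0 mA hA.
pose A' (o : option I) := if o is Some i then A i else A0.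
have mA' o : measurable (A' o) by case: o.
pose a1 (o : option I) := if o is Some i then a i else -1.
have sumE (g : option I -> R) : \sum_o g o = g None + \sum_i g (Some i).
  rewrite (bigD1 None) //=; congr (_ + _).
  rewrite (reindex_omap (Some : I -> _) id) //=; last by case.
  by apply: eq_bigl => i; rewrite eqxx.
have h1 : {ae P, forall w, 0 <= \sum_o a1 o * cP (A' o) w}.
  by apply: cond_prob_lin_ge0 => // D FD; rewrite sumE /= (hA D FD) mulN1r addNr.
have h2 : {ae P, forall w, 0 <= \sum_o - a1 o * cP (A' o) w}.
  apply: cond_prob_lin_ge0 => // D FD; rewrite sumE /= (hA D FD) opprK mul1r.
  by rewrite -big_split /= big1 // => i _; rewrite mulNr subrr.
apply: filterS2 h1 h2 => w; rewrite !sumE /= mulN1r opprK mul1r.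
have -> : \sum_i - a i * cP (A i) w = - \sum_i a i * cP (A i) w.
  by rewrite -sumrN; apply: eq_bigr => i _; rewrite mulNr.
by move=> h1 h2; apply/eqP; rewrite eq_le; apply/andP; split; lra.
Qed.

Lemma cond_prob_ge0 (A : set T) : measurable A -> {ae P, forall w, 0 <= cP A w}.
Proof.
move=> mA; have : {ae P, forall w, 0 <= \sum_(i : 'I_1) 1 * cP A w}.
  apply: (@cond_prob_lin_ge0 _ (fun=> 1) (fun=> A)) => // D FD.
  by rewrite big_ord1 mul1r fine_prob_ge0.
by apply: filterS => w; rewrite big_ord1 mul1r.
Qed.

End conditional_probability.

(** * Markov property of the mixture *)

Definition future_avoids (R : realType) (T : Type) (n : nat)
    (X : R -> T -> state n) (r : seq (R * {set state n})) : set T :=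
  [set w | all (fun v : R * {set state n} => X v.1 w \notin v.2) r].

(* [avoid_prob Q t r x] is the probability that a Markov jump process with
   intensity [Q], at [x] at time [t], avoids each set of [r] at the
   corresponding time. *)
Fixpoint avoid_prob (R : realType) (n : nat) (Q : 'M[R]_(n + 1)) (t : R)
    (r : seq (R * {set state n})) (x : state n) : R :=
  if r is v :: r' then
    \sum_(y | y \notin v.2)
      expmx ((v.1 - t) *: Q) x y * avoid_prob Q v.1 r' y
  else 1.

Section markov_mixture.
Context d (T : measurableType d) (R : realType) (P : probability T R).
Context (n m : nat) (B : 'I_m -> 'M[R]_n) (pi0 : 'I_n -> R)
  (s : 'I_m -> 'I_n -> R) (phi : T -> 'I_m) (X : R -> T -> state n).
Hypothesis hX : mixture_process P B pi0 s phi X.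
Implicit Types (t u : R) (x y : state n) (k : 'I_m) (h : seq (R * state n))
  (r : seq (R * {set state n})).

Let past h t x k : set T :=
  history_is X h `&` at_state X t x `&` regime_is phi k.

Lemma measurable_history h : all (fun v => 0 <= v.1) h ->
  measurable (history_is X h).
Proof.
elim: h => [_|v h IH /= /andP[v0 h0]].
  by rewrite (_ : history_is _ _ = setT) //; apply/seteqP.
rewrite (_ : history_is _ _ = at_state X v.1 v.2 `&` history_is X h).
  by apply: measurableI; [exact: (mp_state_measurable hX)|exact: IH].
apply/seteqP; split => w /=; rewrite /history_is /at_state /=.
  by move=> /andP[/eqP].
by move=> [-> ->]; rewrite eqxx.
Qed.

Lemma measurable_past h t x k : 0 <= t -> all (fun v => 0 <= v.1 <= t) h ->
  measurable (past h t x k).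
Proof.
move=> t0 ht; apply: measurableI; last exact: (mp_regime_measurable hX).
apply: measurableI; last exact: (mp_state_measurable hX).
by apply: measurable_history; apply: sub_all ht => v /andP[].
Qed.

Lemma state_cases x : x = Delta n \/ exists i, x = trans i.
Proof.
rewrite -[x]splitK; case: (fintype.split x) => j /=; first by right; exists j.
by left; rewrite /Delta [j]ord1.
Qed.

(** The Markov property is assumed given both regime and initial state. For a fixed regime the
    transition matrix does not depend on the initial state, so summing over the latter removes it.
    The product form also covers null pasts. *)
Lemma markov_step h t u x y k : 0 <= t -> 0 <= u ->
  all (fun v => 0 <= v.1 <= t) h ->
  fine (P (at_state X (t + u) y `&` past h t x k)) =
  fine (P (past h t x k)) * expmx (u *: Qmx (B k)) x y.
Proof.
move=> t0 u0 ht; have tu0 : 0 <= t + u by exact: addr_ge0.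
have mst := mp_state_measurable hX; have mX0 j := mst 0 j (lexx 0).
have mp := measurable_past x k t0 ht.
have mn : measurable (at_state X (t + u) y `&` past h t x k).
  by apply: measurableI => //; exact: mst.
rewrite (fine_prob_total P mX0 mn) (fine_prob_total P mX0 mp) mulr_suml.
apply: eq_bigr => j _.
have mpj : measurable (past h t x k `&` at_state X 0 j) by exact: measurableI.
have mnj : measurable (at_state X (t + u) y `&` past h t x k `&` at_state X 0 j).
  exact: measurableI.
have [p0|pn0] := eqVneq (fine (P (past h t x k `&` at_state X 0 j))) 0.
  rewrite p0 mul0r; apply: fine_prob_eq0 p0 => //.
  by rewrite -setIA; exact: subIsetr.
(* Starting in [Delta] has probability zero, against [pn0]. *)
have [jD|[i ji]] := state_cases j.
  case/eqP: pn0; apply: (fine_prob_eq0 _ (mX0 j)) => //.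
  by rewrite jD (mp_init_Delta hX).
subst j; set C := regime_is phi k `&` at_state X 0 (trans i).
have mC : measurable C by apply: measurableI => //; exact: (mp_regime_measurable hX).
have pastE : past h t x k `&` at_state X 0 (trans i) =
    history_is X h `&` at_state X t x `&` C by rewrite /past /C !setIA.
have pgt0 : (0 < P (past h t x k `&` at_state X 0 (trans i)))%E.
  by rewrite -fine_probK // lte_fin lt_def pn0 fine_prob_ge0.
have C0 : (0 < P C)%E.
  apply: (lt_le_trans pgt0); apply: le_measure; rewrite ?inE // pastE.
  exact: subIsetr.
have [Pt [PtS hPt _ hM]] := mp_markov hX C0.
have := hM t u x y h t0 u0 ht; rewrite -/C -pastE => /(_ pgt0).
rewrite (transition_semigroup_expmx (mp_intensity hX k) PtS hPt u0) => <-.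
by rewrite /cpr setIA mulrC divfK.
Qed.

Lemma measurable_future_avoids t r : 0 <= t -> path <=%R t (map fst r) ->
  measurable (future_avoids X r).
Proof.
elim: r t => [|v r IH] t t0 /=.
  by move=> _; rewrite (_ : future_avoids _ _ = setT) //; apply/seteqP.
move=> /andP[tv vr]; have v0 := le_trans t0 tv.
rewrite (_ : future_avoids _ _ =
    \big[setI/setT]_(y in v.2) ~` at_state X v.1 y `&` future_avoids X r).
  apply: measurableI; last exact: IH vr.
  by apply: bigsetI_measurable => y _; apply: measurableC; exact: (mp_state_measurable hX).
apply/seteqP; split => w /=; rewrite /future_avoids /=.
  move=> /andP[Xv ->]; split => //; elim/big_ind : _ => // y yv /= Xy.
  by move: Xv; rewrite Xy yv.
move=> [+ ->]; rewrite andbT => hw; apply/negP => Xv; move: hw.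
by rewrite (bigD1 (X v.1 w)) //= => -[+ _]; apply.
Qed.

(** Induction on the future: sum over the allowed states at the next time, move the pair [(t, x)]
    into the history, and evaluate one transition by [markov_step]. *)
Lemma markov_future r h t x k : 0 <= t -> path <=%R t (map fst r) ->
  all (fun v => 0 <= v.1 <= t) h ->
  fine (P (future_avoids X r `&` past h t x k)) =
  fine (P (past h t x k)) * avoid_prob (Qmx (B k)) t r x.
Proof.
elim: r h t x => [|v r IH] h t x t0 /=.
  move=> _ _; rewrite mulr1; congr (fine (P _)); apply/seteqP; split => w; first by case.
  by split.
move=> /andP[tv vr] ht; have v0 := le_trans t0 tv.
have mf : measurable (future_avoids X (v :: r) `&` past h t x k).
  apply: measurableI; last exact: measurable_past.
  by apply: measurable_future_avoids t0 _; rewrite /= tv vr.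
rewrite (fine_prob_total P (fun y => mp_state_measurable hX y v0) mf).
rewrite (bigID (fun y => y \in v.2)) /= big1 ?add0r; last first.
  move=> y yv; rewrite (_ : _ `&` _ = set0) ?measure0 //; apply/seteqP.
  by split => // w [[/andP[+ _] _] /= Xy]; rewrite Xy yv.
rewrite mulr_sumr; apply: eq_bigr => y yv.
have hth : all (fun v' => 0 <= v'.1 <= v.1) ((t, x) :: h).
  by rewrite /= t0 tv; apply: sub_all ht => v' /andP[-> /le_trans->].
have -> : future_avoids X (v :: r) `&` past h t x k `&` [set w | X v.1 w = y] =
    future_avoids X r `&` past ((t, x) :: h) v.1 y k.
  apply/seteqP; split => w; rewrite /past /future_avoids /history_is /at_state /regime_is /=.
    by move=> [[/andP[_ ->] [[-> ->] ->]] ->]; rewrite eqxx.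
  by move=> [-> [[/andP[/eqP -> ->] ->] ->]]; rewrite yv.
rewrite IH // mulrA; congr (_ * _).
rewrite -(markov_step x y k t0 _ ht) ?subr_ge0 // addrC subrK; congr (fine (P _)).
apply/seteqP; split => w; rewrite /past /history_is /at_state /regime_is /=.
  by move=> [[/andP[/eqP -> ->] ->] ->].
by move=> [-> [[-> ->] ->]]; rewrite eqxx.
Qed.

Lemma strict_past_measurable t : strict_past X t `<=` measurable.
Proof.
apply: smallest_sub; first exact: sigma_algebra_measurable.
by move=> _ [u [j [/andP[u0 _] ->]]]; exact: (mp_state_measurable hX).
Qed.

(* Dynkin's argument, from cylinders to the strict past. *)
Lemma markov_strict_past t r x k (D : set T) : 0 <= t ->
  path <=%R t (map fst r) -> strict_past X t D ->
  fine (P (D `&` (future_avoids X r `&` (at_state X t x `&` regime_is phi k)))) =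
  fine (P (D `&` (at_state X t x `&` regime_is phi k))) *
    avoid_prob (Qmx (B k)) t r x.
Proof.
move=> t0 tr.
set E := at_state X t x `&` regime_is phi k; set c := avoid_prob _ _ _ _.
have mE : measurable E.
  by apply: measurableI; [exact: (mp_state_measurable hX)|
    exact: (mp_regime_measurable hX)].
have mf : measurable (future_avoids X r `&` E).
  by apply: measurableI => //; exact: measurable_future_avoids tr.
pose H := [set D : set T | measurable D /\
  fine (P (D `&` (future_avoids X r `&` E))) = fine (P (D `&` E)) * c].
(* Cylinders are stable under intersection, by concatenating histories, and they generate a
   sigma-algebra containing the strict past. *)
pose G := [set D : set T | exists2 h, all (fun v => 0 <= v.1 <= t) h &
  D = history_is X h].
have GH : G `<=` H.
  move=> _ [h ht ->]; split.
    by apply: measurable_history; apply: sub_all ht => v /andP[].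
  have := markov_future x k t0 tr ht.
  by rewrite /past -!setIA setICA.
suff sGH : <<s G >> `<=` H.
  move=> hD; suff [] : H D by []; apply: sGH; apply: hD; split.
    exact: smallest_sigma_algebra.
  move=> _ [u [j [/andP[u0 ut] ->]]]; apply: sub_sigma_algebra.
  exists [:: (u, j)]; rewrite /= ?u0 ?(ltW ut) //.
  by apply/seteqP; split => w; rewrite /at_state /history_is /= ?andbT => /eqP.
apply: lambda_system_subset => //.
  move=> _ _ [h1 ht1 ->] [h2 ht2 ->]; exists (h1 ++ h2).
    by rewrite all_cat ht1 ht2.
  apply/seteqP; split => w; rewrite /history_is /= all_cat.
    by move=> [-> ->].
  by move/andP.
split => //.
- by apply: GH; exists [::] => //; apply/seteqP.
- move=> A C CA [mA hA] [mC hC]; split; first exact: measurableD.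
  have AE (S : set T) : measurable S ->
      fine (P ((A `\` C) `&` S)) = fine (P (A `&` S)) - fine (P (C `&` S)).
    move=> mS; rewrite -fine_probD //; [|exact: measurableI..|exact: setSI].
    congr (fine (P _)); apply/seteqP; split => w.
      by move=> [[Aw nC] Sw]; split => // -[].
    by move=> [[Aw Sw] nC]; split => //; split => // Cw; apply: nC.
  by rewrite !AE // hA hC mulrBl.
(* Both sides are continuous along increasing unions, so equality passes to the limit. *)
- move=> F ndF hF; have mF i : measurable (F i) by case: (hF i).
  split; first exact: bigcup_measurable.
  have h1 := cvg_fine_prob (P := P) mF mf ndF.
  have h2 : fine (P (F i `&` E)) * c @[i --> \oo] -->
      fine (P (\bigcup_i F i `&` E)) * c.
    by apply: cvgMl; exact: cvg_fine_prob.
  rewrite -(cvg_lim _ h1) // -(cvg_lim _ h2) //.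
  rewrite (_ : (fun i => fine (P (F i `&` E)) * c) =
    fun i => fine (P (F i `&` (future_avoids X r `&` E)))) //.
  by apply/funext => i; case: (hF i).
Qed.

End markov_mixture.

(** * Hitting times of closed sets *)

Section hitting_times.
Context d (T : measurableType d) (R : realType) (P : probability T R).
Context (n m : nat) (B : 'I_m -> 'M[R]_n) (pi0 : 'I_n -> R)
  (s : 'I_m -> 'I_n -> R) (phi : T -> 'I_m) (X : R -> T -> state n).
Hypothesis hX : mixture_process P B pi0 s phi X.
Implicit Types (S : {set state n}) (r : seq (R * {set state n})).

(** This reduces the event to countably many times. A path is constant just after each [v < u], so
    some rational below [u] sees the value at [v]; time [u] itself has no such witness and is tested
    separately. Constancy after [u] makes the inequality strict. *)
Lemma lt_hitting_time S (u : R) w : 0 <= u ->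
  (u%:E < hitting_time X S w)%E <->
  X u w \notin S /\
    forall q : rat, 0 <= (ratr q : R) <= u -> X (ratr q) w \notin S.
Proof.
move=> u0; have rc := mp_right_continuous hX w; split=> [uS|[Xu Xq]].
  have avoid v : 0 <= v <= u -> X v w \notin S.
    move=> /andP[v0 vu]; apply/negP => XS; move: uS; apply/negP; rewrite -leNgt.
    apply: (@le_trans _ _ v%:E); last by rewrite lee_fin.
    by apply: ereal_inf_lbound; exists v.
  by split=> [|q]; [apply: avoid; rewrite u0 lexx|exact: avoid].
have right v : 0 <= v -> exists2 e : R, 0 < e &
    forall z, v < z -> z < v + e -> X z w = X v w.
  move=> v0; have : nbhs v (fun z => v < z -> X z w = X v w) := rc v v0.
  move=> /nbhs_ballP[e /= e0 he]; exists e => // z vz ze; apply: he => //.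
  by rewrite /ball /= distrC gtr0_norm ?subr_gt0 // ltrBlDl.
have avoid v : 0 <= v <= u -> X v w \notin S.
  move=> /andP[v0]; rewrite le_eqVlt => /predU1P[->//|vu].
  have [e e0 he] := right v v0.
  have /rat_in_itvoo[q] : v < Num.min u (v + e) by rewrite lt_min vu ltrDl.
  rewrite in_itv /= lt_min => /and3P[vq qu qe].
  by rewrite -(he (ratr q)) //; apply: Xq; rewrite (ltW (le_lt_trans v0 vq)) ltW.
have [e e0 he] := right u u0.
apply: (@lt_le_trans _ _ (u + e)%:E); first by rewrite lte_fin ltrDl.
apply: le_ereal_inf_tmp => _ [v [v0 XS] <-]; rewrite lee_fin leNgt; apply/negP => vue.
have [uv|vu] := ltP u v; first by move: Xu; rewrite -(he v) // XS.
by move: (avoid v); rewrite v0 vu XS => /(_ isT).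
Qed.

Lemma measurable_notin S (u : R) : 0 <= u -> measurable [set w | X u w \notin S].
Proof.
move=> u0.
have -> : [set w | X u w \notin S] = future_avoids X [:: (u, S)].
  by apply/seteqP; split => w; rewrite /future_avoids /= andbT.
by apply: (measurable_future_avoids hX (lexx 0)); rewrite /= u0.
Qed.

Lemma measurable_lt_hitting_time S (u : R) : 0 <= u ->
  measurable [set w | (u%:E < hitting_time X S w)%E].
Proof.
(* [q] enumerates the rationals, with value 0 at integers that code none. *)
move=> u0; pose q (k : nat) : rat := odflt 0 (unpickle k).
have -> : [set w | (u%:E < hitting_time X S w)%E] =
    [set w | X u w \notin S] `&` \bigcap_k
      [set w | 0 <= (ratr (q k) : R) <= u -> X (ratr (q k)) w \notin S].
  apply/seteqP; split => w /=.
    by move=> /lt_hitting_time[//|Xu Xq]; split => // k _; exact: Xq.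
  move=> [Xu Xq]; apply/lt_hitting_time => //; split => // q'.
  by have := Xq (pickle q') I; rewrite /= /q pickleK.
apply: measurableI; first exact: measurable_notin.
apply: bigcapT_measurable => k; have [/andP[q0 qu]|qn] := boolP (0 <= (ratr (q k) : R) <= u).
  rewrite (_ : [set w | _] = [set w | X (ratr (q k)) w \notin S]).
    exact: measurable_notin.
  by apply/seteqP; split => w /= Xq; [exact: Xq|].
by rewrite (_ : [set w | _] = setT) //; apply/seteqP.
Qed.

(** The exceptional event is a finite union over pairs of states; each piece is null because, in
    every regime, the transition probability out of [S] is zero. *)
Lemma closed_absorbing S (v u : R) : stochastically_closed B S -> 0 <= v -> v <= u ->
  {ae P, forall w, X u w \notin S -> X v w \notin S}.
Proof.
move=> SC v0 vu; have u0 := le_trans v0 vu; have mst := mp_state_measurable hX.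
have null x y : x \in S -> y \notin S ->
    {ae P, forall w, ~ (X v w = x /\ X u w = y)}.
  move=> xS yS; pose A := at_state X v x `&` at_state X u y.
  have mA : measurable A by apply: measurableI; exact: mst.
  exists A; split => //; last by move=> w /contrapT.
  rewrite -fine_probK // (fine_prob_total P (mp_regime_measurable hX) mA) big1 // => k _.
  have h0 : all (fun z : R * state n => 0 <= z.1 <= v) [::] by [].
  have := markov_step hX x y k v0 _ h0; move/(_ (u - v)); rewrite subr_ge0 => /(_ vu).
  rewrite addrC subrK (expmx_closed _ (SC k) xS yS) mulr0 => <-.
  congr (fine (P _)); apply/seteqP; split => w; rewrite /A /at_state /history_is /regime_is /=.
    by move=> [[-> ->] ->].
  by move=> [-> [[_ ->] ->]].
have : {ae P, forall w, forall x y, x \in S -> y \notin S -> ~ (X v w = x /\ X u w = y)}.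
  apply: filter_forall => x; apply: filter_forall => y.
  have [xS|xS] := boolP (x \in S); last by apply: nearW.
  have [yS|yS] := boolP (y \notin S); last by apply: nearW.
  by move: (null x y xS yS); apply: filterS => w h _ _.
by apply: filterS => w h Xu; apply/negP => Xv; exact: (h _ _ Xv Xu).
Qed.

(** Absorption holds outside a null set depending on the earlier time; restricting to rational times
    leaves a countable union of null sets. *)
Lemma notin_lt_hitting_time S (u : R) : stochastically_closed B S -> 0 <= u ->
  {ae P, forall w, X u w \notin S <-> (u%:E < hitting_time X S w)%E}.
Proof.
move=> SC u0.
have : {ae P, forall w, forall k : nat, let q : rat := odflt 0 (unpickle k) in
    0 <= (ratr q : R) <= u -> X u w \notin S -> X (ratr q) w \notin S}.
  apply: ae_foralln => k /=; set q := odflt _ _.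
  have [/andP[q0 qu]|_] := boolP (0 <= (ratr q : R) <= u); last exact: nearW.
  by move: (closed_absorbing SC q0 qu); apply: filterS => w h _; exact: h.
apply: filterS => w h; split => [Xu|/lt_hitting_time[]//].
apply/lt_hitting_time => //; split => // q qu.
by have := h (pickle q); rewrite pickleK => /(_ qu Xu).
Qed.

Definition late_hits r : set T :=
  [set w | forall v, v \in r -> (v.1%:E < hitting_time X v.2 w)%E].

Lemma measurable_late_hits r : (forall v, v \in r -> 0 <= v.1) ->
  measurable (late_hits r).
Proof.
elim: r => [_|v r IH hr].
  by rewrite (_ : late_hits _ = setT) //; apply/seteqP; split.
have -> : late_hits (v :: r) =
    [set w | (v.1%:E < hitting_time X v.2 w)%E] `&` late_hits r.
  apply/seteqP; split => w /= h.
    by split => [|z zr]; apply: h; rewrite inE ?eqxx // zr orbT.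
  by case: h => hv h z; rewrite inE => /predU1P[->//|]; exact: h.
apply: measurableI.
  by apply: measurable_lt_hitting_time; apply: hr; rewrite inE eqxx.
by apply: IH => z zr; apply: hr; rewrite inE zr orbT.
Qed.

Lemma future_avoids_late_hits r :
  (forall v, v \in r -> 0 <= v.1 /\ stochastically_closed B v.2) ->
  {ae P, forall w, future_avoids X r w <-> late_hits r w}.
Proof.
elim: r => [_|v r IH hr]; first by apply: nearW => w; split.
have [v0 vC] : 0 <= v.1 /\ stochastically_closed B v.2.
  by apply: hr; rewrite inE eqxx.
have IHr : {ae P, forall w, future_avoids X r w <-> late_hits r w}.
  by apply: IH => z zr; apply: hr; rewrite inE zr orbT.
apply: filterS2 (notin_lt_hitting_time vC v0) IHr => w h1 h2; split.
  rewrite /future_avoids /= => /andP[/h1 hv /h2 hr' z].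
  by rewrite inE => /predU1P[->//|]; exact: hr'.
move=> h; rewrite /future_avoids /=; apply/andP; split.
  by apply/h1/h; rewrite inE eqxx.
by apply/h2 => z zr; apply: h; rewrite inE zr orbT.
Qed.

End hitting_times.

(** * The survival product *)

(** The survival product written with the same recursion as [avoid_prob], so that the two can be
    compared by induction. *)
Fixpoint avoid_mx (R : realType) (n : nat) (A : 'M[R]_n) (t : R)
    (r : seq (R * {set state n})) : 'M[R]_n :=
  if r is v :: r' then
    expmx ((v.1 - t) *: A) *m Hmx R v.2 *m avoid_mx A v.1 r'
  else 1%:M.

Lemma avoid_mxE (R : realType) (n p : nat) (A : 'M[R]_n) (t : R)
    (f : 'I_p -> R * {set state n}) :
  let ts := t :: [seq (f l).1 | l <- enum 'I_p] in
  \prod_(l < p) (expmx ((ts`_l.+1 - ts`_l) *: A) *m Hmx R (f l).2) =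
  avoid_mx A t [seq f l | l <- enum 'I_p].
Proof.
elim: p t f => [|p IH] t f ts; first by rewrite big_ord0 enum_ord0.
rewrite big_ord_recl {}/ts enum_ordSl !map_cons -!(map_comp _ (lift ord0)).
by apply: (congr2 (@mulmx _ _ _ _)) => //; exact: (IH (f ord0).1 (f \o lift ord0)).
Qed.

(** As [Delta] is forbidden at every time, the sums run over transient states only; the restriction
    to allowed states becomes the factor [Hmx]. *)
Lemma avoid_prob_trans (R : realType) (n : nat) (A : 'M[R]_n) (t : R)
    (r : seq (R * {set state n})) j :
  (forall v, v \in r -> Delta n \in v.2) ->
  avoid_prob (Qmx A) t r (trans j) =
  (avoid_mx A t r *m (const_mx 1 : 'cV_n)) j ord0.
Proof.
elim: r t j => [|v r IH] t j hr /=; first by rewrite mul1mx mxE.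
have Dv : Delta n \in v.2 by apply: hr; rewrite inE eqxx.
rewrite -2!mulmxA mxE big_mkcond big_split_ord /= big_ord1 ifN; last first.
  by rewrite negbK.
rewrite addr0; apply: eq_bigr => i _.
rewrite mul_diag_mx mxE mxE -IH; last by move=> z zr; apply: hr; rewrite inE zr orbT.
rewrite expmx_Qmx_trans /trans; case: ifP => _; last by rewrite mul0r mulr0.
by rewrite mul1r.
Qed.

Lemma avoid_prob_closed (R : realType) (n : nat) (Q : 'M[R]_(n + 1)) (t : R)
    (v : R * {set state n}) (r : seq (R * {set state n})) x :
  (forall i j, i \in v.2 -> j \notin v.2 -> Q i j = 0) -> x \in v.2 ->
  avoid_prob Q t (v :: r) x = 0.
Proof.
by move=> Qv xv /=; rewrite big1 // => y yv; rewrite (expmx_closed _ Qv) ?mul0r.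
Qed.

(** * Conditional joint law of the hitting times *)

Theorem proposition3p18 (R : realType) (d : measure_display)
    (T : measurableType d) (P : probability T R) (n m p : nat)
    (B : 'I_m -> 'M[R]_n) (pi0 : 'I_n -> R) (s : 'I_m -> 'I_n -> R)
    (phi : T -> 'I_m) (X : R -> T -> state n)
    (G : 'I_p -> {set state n})
    (t : R) (tt : 'I_p -> R) (i : 'S_p)
    (F : set (set T)) (cP : set T -> T -> R)
    (alive : bool) (c : 'I_m -> 'I_n -> T -> R)
    (hX : mixture_process P B pi0 s phi X)
    (hG_nonempty : forall l, G l != finset.set0)
    (hG_closed : forall l, stochastically_closed B (G l))
    (hG_cap : (\bigcap_(l < p) G l)%SET = [set Delta n]%SET)
    (hpi0 : forall j : 'I_n, (forall l, trans j \notin G l) -> pi0 j != 0)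
    (htau : P [set w | forall l, (0 < hitting_time X (G l) w)%E] = 1%E)
    (ht : 0 <= t)
    (htt : sorted <=%R (ordered_times t tt i))
    (hF_sigma : sigma_algebra setT F)
    (hF_past : F `<=` strict_past X t)
    (hcP : cond_prob P F cP)
    (hc_ge0 : forall k j w, 0 <= c k j w)
    (hc_sum : forall j w, \sum_k c k j w = 1) :
  {ae P, forall w,
    cond_G_defined cP X t alive w ->
    cond_G cP X t alive
      [set w' | forall l : 'I_p,
                  ((tt (i l))%:E < hitting_time X (G (i l)) w')%E] w
    = (\sum_(k < m) pi_row cP X t alive w *m Smx cP phi X c t k w *m
         survival_product (B k) G t tt i *m (const_mx 1 : 'cV[R]_n))
        ord0 ord0}
  /\ {ae P, forall w, \sum_(k < m) Smx cP phi X c t k w = 1%:M}.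
Proof.
set ev := [set w' | _].
have F_meas : F `<=` measurable.
  by move=> D /hF_past; exact: (strict_past_measurable hX).
have mst j : measurable (at_state X t j) by exact: (mp_state_measurable hX).
have mreg := mp_regime_measurable hX.
have mXt j : measurable [set w | X t w = j] := mst j.
have mphi k : measurable [set w | phi w = k] := mreg k.
pose f l := (tt (i l), G (i l)); pose r := [seq f l | l <- enum 'I_p].
have tr : path <=%R t (map fst r).
  by move: htt; rewrite /ordered_times /= /r -map_comp.
have rP v : v \in r -> [/\ 0 <= v.1, stochastically_closed B v.2 & Delta n \in v.2].
  move=> vr; split.
  - have /allP : all (>= t) (map fst r) by exact: order_path_min le_trans tr.
    by move=> /(_ v.1 (map_f _ vr)); exact: le_trans.
  - by case/mapP: vr => l _ ->; exact: hG_closed.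
  - case/mapP: vr => l _ ->; have := set11 (Delta n); rewrite -hG_cap.
    by move/bigcapP; apply.
have evE : ev = late_hits X r.
  apply/seteqP; split => w h; first by move=> _ /mapP[l _ ->]; exact: h.
  by move=> l; apply: (h (f l)); apply: map_f; rewrite mem_enum.
have mev : measurable ev.
  by rewrite evE; apply: (measurable_late_hits hX) => v /rP[].
have mfut : measurable (future_avoids X r) by exact: (measurable_future_avoids hX ht tr).
have aeev : {ae P, forall w, future_avoids X r w <-> ev w}.
  by rewrite evE; apply: (future_avoids_late_hits hX) => v /rP[].
(* A path already absorbed at time [t] lies in the first closed set and cannot leave it. *)
have avoidD k : avoid_prob (Qmx (B k)) t r (Delta n) = 0.
  case er : r => [|v r']; last first.
    have [_ vC vD] : [/\ 0 <= v.1, stochastically_closed B v.2 & Delta n \in v.2].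
      by apply: rP; rewrite er inE eqxx.
    by rewrite avoid_prob_closed //; exact: vC.
  (* Without closed sets, [Delta] is the only state: impossible as [X 0] is
     almost surely transient. *)
  have p0 : p = 0%N by move: er => /(congr1 size); rewrite size_map size_enum_ord.
  have XD : at_state X 0 (Delta n) = setT.
    apply/seteqP; split => // w _ /=; apply/eqP; rewrite -finset.in_set1 -hG_cap.
    by apply/bigcapP => l; move: (ltn_ord l); rewrite [X in (_ < X)%N]p0.
  have := mp_init_Delta hX; rewrite XD probability_setT => /eqP.
  by rewrite eqe oner_eq0.
pose A k j := regime_is phi k `&` at_state X t (trans j).
have mA k j : measurable (A k j) by exact: measurableI.
pose v k j := (avoid_mx (B k) t r *m (const_mx 1 : 'cV_n)) j ord0.
(* Keeping [K] general treats both forms of the information at once: it must contain the transient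
   states at time [t], while [Delta] contributes zero in any case. *)
have cond_ev K : measurable K -> (forall j, at_state X t (trans j) `<=` K) ->
    {ae P, forall w, cP (ev `&` K) w = \sum_k \sum_j v k j * cP (A k j) w}.
  move=> mK hK.
  have : {ae P, forall w, cP (ev `&` K) w =
      \sum_(q : 'I_m * 'I_n) v q.1 q.2 * cP (A q.1 q.2) w}.
    apply: (cond_prob_lin hF_sigma F_meas hcP) => //; first exact: measurableI.
    move=> D FD; have mD := F_meas D FD.
    have -> : fine (P (ev `&` K `&` D)) =
        fine (P (D `&` (future_avoids X r `&` K))).
      apply: fine_prob_ae_eq.
      - by do !apply: measurableI => //.
      - by do !apply: measurableI => //.
      - by apply: filterS aeev => w [h1 h2]; split=> [[[/h2 ? ?] ?]|[? [/h1 ? ?]]].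
    rewrite (fine_prob_total P mreg); last first.
      by do !apply: measurableI => //.
    rewrite -(pair_bigA _ (fun k j => v k j * fine (P (A k j `&` D)))) /=.
    apply: eq_bigr => k _.
    rewrite (fine_prob_total P mst); last first.
      by do !apply: measurableI => //.
    have hMk x := markov_strict_past hX x k ht tr (hF_past _ FD).
    (* The term for [Delta] lies in an event that is null by [avoidD]. *)
    rewrite big_split_ord /= big_ord1 [X in _ + X](_ : _ = 0) ?addr0; last first.
      have := hMk (Delta n); rewrite avoidD mulr0; apply: fine_prob_eq0.
      - by do !apply: measurableI => //.
      - by do !apply: measurableI => //.
      - by move=> w [[[Dw [fw _]] kw] tw].
    apply: eq_bigr => j _; rewrite mulrC.
    have -> : A k j `&` D = D `&` (at_state X t (trans j) `&` regime_is phi k).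
      by rewrite setIC /A [_ `&` at_state _ _ _]setIC.
    rewrite /v -avoid_prob_trans; last by move=> z /rP[].
    rewrite -hMk; congr (fine (P _)); apply/seteqP; split => w.
      by move=> [[[Dw [fw _]] kw] tw].
    by move=> [Dw [fw [tw kw]]]; split => //; split => //; split => //; split => //; exact: hK tw.
  by apply: filterS => w ->; rewrite -(pair_bigA _ (fun k j => v k j * cP (A k j) w)).
have cond_at j : {ae P, forall w,
    cP (at_state X t (trans j)) w = \sum_k cP (A k j) w}.
  have : {ae P, forall w,
      cP (at_state X t (trans j)) w = \sum_k 1 * cP (A k j) w}.
    apply: (cond_prob_lin hF_sigma F_meas hcP) => // D FD; have mD := F_meas D FD.
    rewrite (fine_prob_total P mreg); last exact: measurableI.
    apply: eq_bigr => k _; rewrite mul1r; congr (fine (P _)).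
    by rewrite /A setIAC [X in X `&` D]setIC.
  by apply: filterS => w ->; apply: eq_bigr => k _; rewrite mul1r.
have {}cond_at : {ae P, forall w, forall j,
    cP (at_state X t (trans j)) w = \sum_k cP (A k j) w}.
  exact: filter_forall.
have cond_ge0 : {ae P, forall w, forall k j, 0 <= cP (A k j) w}.
  apply: filter_forall => k; apply: filter_forall => j.
  exact: (cond_prob_ge0 hF_sigma F_meas hcP).
have Smx_entry k w j1 j2 : Smx cP phi X c t k w j1 j2 =
    (if 0 < cP (at_state X t (trans j1)) w
     then cP (A k j1) w / cP (at_state X t (trans j1)) w
     else c k j1 w) *+ (j1 == j2).
  by rewrite !mxE.
split; last first.
  apply: filterS2 cond_at cond_ge0 => w hat hge0.
  apply/matrixP => j1 j2; rewrite summxE mxE.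
  under eq_bigr do rewrite Smx_entry.
  rewrite sumrMnl; congr (_ *+ _).
  have [pos|_] := boolP (0 < cP (at_state X t (trans j1)) w); last exact: hc_sum.
  by rewrite -mulr_suml -hat divff // gt_eqF.
pose K := if alive then ~` at_state X t (Delta n) else setT.
have mK : measurable K by rewrite /K; case: (alive) => //; exact: measurableC.
have hK j : at_state X t (trans j) `<=` K.
  rewrite /K; case: (alive) => // w; rewrite /at_state /= => -> /eqP.
  by rewrite /trans /Delta eq_lrshift.
have eventK := cond_ev K mK hK.
apply: filterS3 eventK cond_at cond_ge0 => w hev hat hge0 _.
(* The left side and every entry of [pi_row] carry the same denominator [z], so the formula reduces
   to [cond_ev] divided by [z]. *)
pose z := if alive then cP (~` at_state X t (Delta n)) w else 1.
have -> : cond_G cP X t alive ev w = cP (ev `&` K) w / z.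
  by rewrite /cond_G /cond_prob_with /K /z; case: (alive) => //; rewrite setIT divr1.
have piE j : pi_row cP X t alive w ord0 j = cP (at_state X t (trans j)) w / z.
  rewrite mxE /cond_G /cond_prob_with /z; move: (hK j); rewrite /K.
  by case: (alive) => [/setIidl->//|_]; rewrite divr1.
rewrite hev mulr_suml summxE; apply: eq_bigr => k _.
rewrite -mulmxA mxE mulr_suml; apply: eq_bigr => j _.
rewrite mul_mx_diag [X in _ = X * _]mxE piE mxE.
have -> : survival_product (B k) G t tt i = avoid_mx (B k) t r.
  by rewrite /r -avoid_mxE.
rewrite -/(v k j); set q := (if _ then _ else _).
(* Where the weight is undefined, the nonnegative terms [cP (A k j) w] sum over [k] to a quantity
   that is at most 0, so all vanish and the completion [c] is multiplied by zero. *)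
have <- : cP (at_state X t (trans j)) w * q = cP (A k j) w.
  rewrite /q; case: ifPn => [pos|npos]; first by rewrite mulrC divfK // gt_eqF.
  have s0 : \sum_k cP (A k j) w = 0.
    by apply/eqP; rewrite eq_le -{1}hat leNgt npos /= sumr_ge0.
  rewrite hat s0 mul0r; apply/esym/eqP; move/eqP: s0.
  by rewrite psumr_eq0 // => /allP/(_ k); rewrite mem_index_enum => /(_ isT).
by ring.
Qed.
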